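(* Let $\mathbf E=(E^S_t)$ be a future-extension coherent dynamic intersection $e$-process collection. For fixed $P\in\mathcal M$, define $$Z_t(P):=\mathbf 1\{\mathcal N_t(P)\ne\varnothing\}\,E_t^{\mathcal N_t(P)}$$ (read as $0$ when $\mathcal N_t(P)=\varnothing$). Then for every $(\mathcal F_t)$-stopping time $\tau$ with $P(\tau<\infty)=1$, $$\mathbb E_P[Z_\tau(P)]\le1 .$$ If $\mathbf E$ is also time-monotone, then $$\mathbb E_P\Big[\sup_{t\ge0}Z_t(P)\Big]\le1 .$$
   Context: Let $(\Omega,\mathcal F,(\mathcal F_t)_{t\in\mathbb N_0})$ be a discrete-time filtered measurable space, $\mathcal M$ a family of probability measures on $(\Omega,\mathcal F)$, $\mathcal I\subseteq\mathbb N$ an index set (finite or infinite), and $H_i\subseteq\mathcal M$, $i\in\mathcal I$, null hypotheses. Put $\mathcal N(P)=\{i\in\mathcal I:P\in H_i\}$ and, for finite $S\subseteq\mathcal I$, $H_S=\bigcap_{i\in S}H_i$ (with $H_\varnothing=\mathcal M$). The active sets $I_t\subseteq\mathcal I$ are deterministic and finite with $I_0\subseteq I_1\subseteq\cdots$ and $\bigcup_t I_t=\mathcal I$. The active true nulls are $\mathcal N_t(P)=\mathcal N(P)\cap I_t$. A nonnegative $(\mathcal F_t)$-adapted process $E=(E_t)_{t\ge0}$ is an $e$-process for $H\subseteq\mathcal M$ if $\mathbb E_P[E_\tau]\le1$ for every $P\in H$ and every $(\mathcal F_t)$-stopping time $\tau$ with $P(\tau<\infty)=1$. A dynamic intersection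 $e$-process collection is a family $\mathbf E=(E^S_t)_{t\ge0,\ S\subseteq\mathcal I,\ 0<|S|<\infty}$ such that $E^S=(E^S_t)_{t\ge0}$ is an $e$-process for $H_S$ for each nonempty finite $S$. It is future-extension coherent if, pointwise on $\Omega$, $E_t^{S\cap I_t}\le E_t^S$ for every $t$ and every finite $S$ with $S\cap I_t\ne\varnothing$. It is time-monotone if, pointwise on $\Omega$, $E^S_t\le E^S_u$ for all $t\le u$ and every finite nonempty $S$. *)

(* Defs.v *)
From HB Require Import structures.
From mathcomp Require Import all_boot all_order all_algebra.
From mathcomp Require Import all_classical all_reals all_analysis.
From mathcomp Require Import measurable_realfun.

Set Implicit Arguments.
Unset Strict Implicit.
Unset Printing Implicit Defensive.

Import Order.TTheory GRing.Theory Num.Theory.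
Local Open Scope classical_set_scope.
Local Open Scope ring_scope.
Local Open Scope ereal_scope.

Definition filtration d (T : measurableType d) (F : nat -> set (set T)) : Prop :=
  [/\ forall t, sigma_algebra setT (F t),
      forall t, F t `<=` measurable
    & forall s t, (s <= t)%N -> F s `<=` F t].

(* Processes take values in [\bar R], so nonnegative processes are
   [0, +oo]-valued; real-valued ones are the special case [EFin \o _]. *)
Definition adapted d (T : measurableType d) (R : realType)
    (F : nat -> set (set T)) (X : nat -> T -> \bar R) : Prop :=
  forall t (B : set (\bar R)), measurable B -> F t (X t @^-1` B).

(* Random times have values in N u {oo}, with [None] standing for oo. *)
Definition stopping_time (T : Type) (F : nat -> set (set T))
    (tau : T -> option nat) : Prop :=
  forall t, F t [set w | exists2 n, tau w = Some n & (n <= t)%N].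

Definition as_finite d (T : measurableType d) (R : realType)
    (P : probability T R) (tau : T -> option nat) : Prop :=
  P [set w | tau w <> None] = 1.

(* The value 0 on {tau = oo} is immaterial: it is only used when that event is
   P-null. *)
Definition stopped (T : Type) (R : realType) (X : nat -> T -> \bar R)
    (tau : T -> option nat) : T -> \bar R :=
  fun w => if tau w is Some t then X t w else 0.

Definition e_process d (T : measurableType d) (R : realType)
    (F : nat -> set (set T)) (H : set (probability T R))
    (X : nat -> T -> \bar R) : Prop :=
  [/\ forall t w, 0 <= X t w,
      adapted F X
    & forall P, H P -> forall tau, stopping_time F tau -> as_finite P tau ->
        \int[P]_w stopped X tau w <= 1].

Definition active_sets (I : set nat) (A : nat -> set nat) : Prop :=
  [/\ forall t, finite_set (A t),
      forall s t, (s <= t)%N -> A s `<=` A t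
    & \bigcup_t A t = I].

Definition true_nulls d (T : measurableType d) (R : realType)
    (I : set nat) (H : nat -> set (probability T R)) (P : probability T R) :
    set nat :=
  [set i | I i /\ H i P].

Definition active_true_nulls d (T : measurableType d) (R : realType)
    (I : set nat) (A : nat -> set nat) (H : nat -> set (probability T R))
    (P : probability T R) (t : nat) : set nat :=
  true_nulls I H P `&` A t.

(* Intersecting with [M] makes H_set0 = M. *)
Definition intersection_null d (T : measurableType d) (R : realType)
    (M : set (probability T R)) (H : nat -> set (probability T R))
    (S : set nat) : set (probability T R) :=
  M `&` \bigcap_(i in S) H i.

Definition finite_subset (I S : set nat) : Prop := finite_set S /\ S `<=` I.

(* A collection is a function of all sets of indices; its values at the empty
   set, at infinite sets and at sets not included in [I] are unconstrained. *)
Definition intersection_e_collection d (T : measurableType d) (R : realType)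
    (F : nat -> set (set T)) (M : set (probability T R)) (I : set nat)
    (H : nat -> set (probability T R)) (E : set nat -> nat -> T -> \bar R) :
    Prop :=
  forall S, finite_subset I S -> S !=set0 ->
    e_process F (intersection_null M H S) (E S).

Definition future_extension_coherent (T : Type) (R : realType)
    (I : set nat) (A : nat -> set nat) (E : set nat -> nat -> T -> \bar R) :
    Prop :=
  forall t S, finite_subset I S -> S `&` A t !=set0 ->
    forall w, E (S `&` A t) t w <= E S t w.

Definition time_monotone (T : Type) (R : realType)
    (I : set nat) (E : set nat -> nat -> T -> \bar R) : Prop :=
  forall t u S, (t <= u)%N -> finite_subset I S -> S !=set0 ->
    forall w, E S t w <= E S u w.

Definition active_null_process d (T : measurableType d) (R : realType)
    (I : set nat) (A : nat -> set nat) (H : nat -> set (probability T R))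
    (E : set nat -> nat -> T -> \bar R) (P : probability T R) :
    nat -> T -> \bar R :=
  fun t w => if `[< active_true_nulls I A H P t !=set0 >]
             then E (active_true_nulls I A H P t) t w else 0.

(* Main.v *)
Require Import Defs.
From HB Require Import structures.
From mathcomp Require Import all_boot all_order all_algebra.
From mathcomp Require Import all_classical all_reals all_analysis.
From mathcomp Require Import measurable_realfun.

(** Fix [P], write [N_t] for the set of active true nulls at time [t] and [Z]
    for the process [Z_t = E^{N_t}_t] (zero while [N_t] is empty).  The index
    set of [Z] changes with time, so [Z] is not itself a member of the
    collection.  Up to a horizon [n], however, it is dominated by a single
    member: as active sets grow, [N_s = N_n `&` A s] for [s <= n], and
    future-extension coherence gives [Z_s <= E^{N_n}_s]
    ([active_null_process_le_horizon]).  Since [P] lies in the intersection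
    null of [N_n], the e-process [E^{N_n}] bounds by 1 the expectation of
    [Z_tau 1{tau <= n}], for each stopping time [tau]
    ([integral_truncated_active_null_le1]).  These truncations increase to
    [Z_tau] on [{tau < oo}], and monotone convergence removes the horizon.

    Under time monotonicity, coherence makes [Z] itself nondecreasing:
    [E^{N_s}_s <= E^{N_t}_s <= E^{N_t}_t].  Its supremum is then a monotone
    limit of the [Z_t], whose expectations are at most 1 by the first part
    applied to constant stopping times. *)

Set Implicit Arguments.
Unset Strict Implicit.
Unset Printing Implicit Defensive.

Import Order.TTheory GRing.Theory Num.Theory.
Local Open Scope classical_set_scope.
Local Open Scope ring_scope.
Local Open Scope ereal_scope.

Lemma integral_ereal_sup_le d (T : measurableType d) (R : realType)
    (mu : measure T R) (f : nat -> T -> \bar R) (c : \bar R) :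
  (forall n, measurable_fun setT (f n)) ->
  (forall n w, 0 <= f n w) ->
  (forall w, {homo f ^~ w : n m / (n <= m)%N >-> n <= m}) ->
  (forall n, \int[mu]_w f n w <= c) ->
  \int[mu]_w ereal_sup (range (f ^~ w)) <= c.
Proof.
move=> mf f0 ndf fc.
have -> : (fun w => ereal_sup (range (f ^~ w))) = (fun w => limn (f ^~ w)).
  apply/funext => w; apply/esym/cvg_lim => //.
  exact: ereal_nondecreasing_cvgn.
have cvgf := @cvg_monotone_convergence _ _ _ mu setT measurableT f mf
  (fun n w _ => f0 n w) (fun w _ => ndf w).
rewrite -(cvg_lim _ cvgf)//; apply: lime_le; first by apply/cvg_ex; eexists; exact: cvgf.
exact: nearW.
Qed.

Section stopping_times.
Variables (d : measure_display) (T : measurableType d) (R : realType).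
Variables (F : nat -> set (set T)) (hF : filtration F).

Lemma stopping_time_const t : stopping_time F (fun=> Some t).
Proof.
move=> u; have [sF _ _] := hF; have [F0 FC _] := sF u.
have [tu|ut] := boolP (t <= u)%N.
  have -> : [set _ : T | exists2 n, Some t = Some n & (n <= u)%N] = setT.
    by apply/seteqP; split=> // w _; exists t.
  by rewrite -(setD0 setT); exact: FC.
have -> // : [set _ : T | exists2 n, Some t = Some n & (n <= u)%N] = set0.
by apply/seteqP; split=> // w [n [<-]] /(negP ut).
Qed.

Lemma as_finite_const (P : probability T R) t : as_finite P (fun=> Some t).
Proof.
rewrite /as_finite -[RHS](probability_setT P); congr (P _).
by apply/seteqP; split.
Qed.

Lemma measurable_stopping_time_eq tau t :
  stopping_time F tau -> measurable [set w | tau w = Some t].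
Proof.
move=> htau; have [_ Fm _] := hF.
have mle u : measurable [set w | exists2 n, tau w = Some n & (n <= u)%N].
  exact/(Fm u)/htau.
have -> : [set w | tau w = Some t] =
    [set w | exists2 n, tau w = Some n & (n <= t)%N] `\`
    \bigcup_(u in [set u | (u < t)%N])
      [set w | exists2 n, tau w = Some n & (n <= u)%N].
  apply/seteqP; split=> w /=.
    move=> tauw; split; first by exists t.
    by move=> [u /= ut [n]]; rewrite tauw => -[<-]; rewrite leqNgt ut.
  move=> [[n tauw nt] nlt]; rewrite tauw; congr Some.
  apply/eqP; rewrite eqn_leq nt /= leqNgt; apply/negP => ltnt.
  by apply: nlt; exists n => //; exists n.
by apply: measurableD => //; exact: bigcup_measurable.
Qed.

Lemma measurable_stopped (X : nat -> T -> \bar R) tau :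
  stopping_time F tau -> (forall t, measurable_fun setT (X t)) ->
  measurable_fun setT (stopped X tau).
Proof.
move=> htau mX _ B mB; rewrite setTI.
have meq t := measurable_stopping_time_eq t htau.
have mNone : measurable [set w | tau w = None].
  have -> : [set w | tau w = None] = ~` \bigcup_t [set w | tau w = Some t].
    apply/seteqP; split=> w /=; first by move=> h [t _ /=]; rewrite h.
    by case tauw : (tau w) => [t|] // h; exfalso; apply: h; exists t.
  by apply: measurableC; exact: bigcupT_measurable.
have -> : stopped X tau @^-1` B =
    \bigcup_t ([set w | tau w = Some t] `&` X t @^-1` B) `|`
    ([set w | tau w = None] `&` [set w | B 0]).
  apply/seteqP; split=> w /=; rewrite /stopped.
    by case tauw: (tau w) => [t|] Bw; [left; exists t | right].
  by case=> [[t _ [/= -> //]]|[-> //]].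
apply: measurableU; last first.
  apply: measurableI => //; have [B0|nB0] := pselect (B 0).
    by have -> : [set _ : T | B 0] = setT by apply/seteqP; split.
  by have -> : [set _ : T | B 0] = set0 by apply/seteqP; split.
apply: bigcupT_measurable => t; apply: measurableI => //.
by rewrite -[X in measurable X]setTI; exact: mX.
Qed.

End stopping_times.

Lemma measurable_adapted d (T : measurableType d) (R : realType)
    (F : nat -> set (set T)) (X : nat -> T -> \bar R) t :
  filtration F -> adapted F X -> measurable_fun setT (X t).
Proof.
by move=> [_ Fm _] aX _ B mB; rewrite setTI; apply: (Fm t); exact: aX.
Qed.

Section active_null_process.
Variables (d : measure_display) (T : measurableType d) (R : realType).
Variables (F : nat -> set (set T)) (hF : filtration F).
Variables (M : set (probability T R)) (I : set nat).
Variables (H : nat -> set (probability T R)).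
Variables (A : nat -> set nat) (hA : active_sets I A).
Variables (E : set nat -> nat -> T -> \bar R).
Hypothesis hE : intersection_e_collection F M I H E.
Hypothesis hcoh : future_extension_coherent I A E.
Variables (P : probability T R) (hP : M P).

Local Notation N := (active_true_nulls I A H P).
Local Notation Z := (active_null_process I A H E P).

Lemma finite_subset_active_true_nulls t : finite_subset I (N t).
Proof.
have [finA _ _] := hA; split; last by move=> i [[]].
by apply: sub_finite_set (finA t) => i [].
Qed.

Lemma active_true_nulls_horizon s n : (s <= n)%N -> N n `&` A s = N s.
Proof.
have [_ homoA _] := hA => sn; apply/seteqP; split=> i /=; first by case=> -[].
by move=> [Ni As]; split=> //; split=> //; exact: homoA As.
Qed.

Lemma e_process_active_true_nulls t : N t !=set0 ->
  e_process F (intersection_null M H (N t)) (E (N t)).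
Proof. by apply: hE; exact: finite_subset_active_true_nulls. Qed.

Lemma intersection_null_active_true_nulls t : intersection_null M H (N t) P.
Proof. by split=> // i [[]]. Qed.

Lemma active_null_process_ge0 t w : 0 <= Z t w.
Proof.
rewrite /active_null_process; case: asboolP => // /e_process_active_true_nulls.
by case=> + _ _; exact.
Qed.

Lemma measurable_active_null_process t : measurable_fun setT (Z t).
Proof.
rewrite /active_null_process; case: asboolP => // /e_process_active_true_nulls.
by case=> _ + _; exact: measurable_adapted.
Qed.

(** One e-process dominates up to the horizon [n], although the index set of
    [Z] changes: coherence compares it with its own past active part. *)
Lemma active_null_process_le_horizon s n w : (s <= n)%N -> N n !=set0 ->
  Z s w <= E (N n) s w.
Proof.
move=> sn Nn0; rewrite /active_null_process; case: asboolP => [Ns0|_].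
  rewrite -{1}(active_true_nulls_horizon sn); apply: hcoh.
    exact: finite_subset_active_true_nulls.
  by rewrite (active_true_nulls_horizon sn).
by have [+ _ _] := e_process_active_true_nulls Nn0; exact.
Qed.

Lemma active_null_process_horizon0 s n w : (s <= n)%N -> ~ (N n !=set0) ->
  Z s w = 0.
Proof.
move=> sn Nn0; rewrite /active_null_process; case: asboolP => // -[i].
by rewrite -(active_true_nulls_horizon sn) => -[Nni _]; case: Nn0; exists i.
Qed.

(** The truncation is put on the process rather than on the stopping time:
    stopping [truncated_active_null n] at [tau] yields [Z_tau 1{tau <= n}],
    which increases with [n], whereas [Z] stopped at [min tau n] need not. *)
Definition truncated_active_null (n t : nat) : T -> \bar R :=
  if (t <= n)%N then Z t else cst 0.

Lemma truncated_active_null_ge0 n t w : 0 <= truncated_active_null n t w.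
Proof.
by rewrite /truncated_active_null; case: ifP => // _;
   exact: active_null_process_ge0.
Qed.

Lemma measurable_stopped_truncated_active_null n tau : stopping_time F tau ->
  measurable_fun setT (stopped (truncated_active_null n) tau).
Proof.
move=> htau; apply: (measurable_stopped hF) => // t.
rewrite /truncated_active_null; case: ifP => // _.
exact: measurable_active_null_process.
Qed.

(** The e-process of [N n] is stopped at [tau] itself, which may exceed [n]:
    nonnegativity covers the event [{tau > n}]. *)
Lemma integral_truncated_active_null_le1 n tau :
  stopping_time F tau -> as_finite P tau ->
  \int[P]_w stopped (truncated_active_null n) tau w <= 1.
Proof.
move=> htau ftau; have [Nn0|Nn0] := pselect (N n !=set0); last first.
  rewrite integral0_eq ?lee01// => w _.
  rewrite /stopped /truncated_active_null; case: (tau w) => // t.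
  by case: ifP => // tn; exact: active_null_process_horizon0 tn Nn0.
have [E0 aE intE] := e_process_active_true_nulls Nn0.
apply: le_trans (intE P (intersection_null_active_true_nulls n) tau htau ftau).
apply: ge0_le_integral => //.
- move=> w _; rewrite /stopped; case: (tau w) => // t.
  exact: truncated_active_null_ge0.
- exact: measurable_stopped_truncated_active_null.
- apply: (measurable_stopped hF) => // t; exact: measurable_adapted hF aE.
- move=> w _; rewrite /stopped /truncated_active_null; case: (tau w) => // t.
  by case: ifP => [tn|_]; [exact: active_null_process_le_horizon | exact: E0].
Qed.

Lemma stopped_active_nullE tau w :
  stopped Z tau w =
  ereal_sup (range (fun n => stopped (truncated_active_null n) tau w)).
Proof.
rewrite /stopped; case: (tau w) => [t|]; last first.
  by rewrite (_ : range _ = [set 0]) ?ereal_sup1// ; apply/seteqP; split;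
     [move=> _ [n _ <-] | move=> _ ->; exists 0%N].
apply/eqP; rewrite eq_le; apply/andP; split.
  by apply: ereal_sup_ubound; exists t => //; rewrite /truncated_active_null leqnn.
apply: ge_ereal_sup => _ [n _ <-]; rewrite /truncated_active_null.
by case: ifP => // _; exact: active_null_process_ge0.
Qed.

Lemma integral_stopped_active_null_le1 tau :
  stopping_time F tau -> as_finite P tau -> \int[P]_w stopped Z tau w <= 1.
Proof.
move=> htau ftau; under eq_integral do rewrite stopped_active_nullE.
apply: integral_ereal_sup_le => [n|n w|w n m nm|n].
- exact: measurable_stopped_truncated_active_null.
- by rewrite /stopped; case: (tau w) => // t; exact: truncated_active_null_ge0.
- rewrite /stopped; case: (tau w) => // t; rewrite {1}/truncated_active_null.
  case: ifPn => [tn|_]; last exact: truncated_active_null_ge0.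
  by rewrite /truncated_active_null (leq_trans tn nm).
- exact: integral_truncated_active_null_le1.
Qed.

Lemma active_null_process_homo w : time_monotone I E ->
  {homo Z ^~ w : s t / (s <= t)%N >-> s <= t}.
Proof.
move=> monoE s t st; have [Nt0|Nt0] := pselect (N t !=set0).
  apply: le_trans (active_null_process_le_horizon w st Nt0) _.
  rewrite /active_null_process asboolT//; apply: monoE => //.
  exact: finite_subset_active_true_nulls.
by rewrite (active_null_process_horizon0 w st Nt0); exact: active_null_process_ge0.
Qed.

End active_null_process.

Theorem lemma3p4 (d : measure_display) (T : measurableType d) (R : realType)
  (F : nat -> set (set T)) (hF : filtration F)
  (M : set (probability T R))
  (I : set nat) (H : nat -> set (probability T R))
  (hH : forall i, I i -> H i `<=` M)
  (A : nat -> set nat) (hA : active_sets I A)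
  (E : set nat -> nat -> T -> \bar R)
  (hE : intersection_e_collection F M I H E)
  (hcoh : future_extension_coherent I A E)
  (P : probability T R) (hP : M P) :
  (forall tau : T -> option nat, stopping_time F tau -> as_finite P tau ->
     \int[P]_w stopped (active_null_process I A H E P) tau w <= 1) /\
  (time_monotone I E ->
     \int[P]_w ereal_sup (range (fun t => active_null_process I A H E P t w)) <= 1).
Proof.
have stopped_le1 := integral_stopped_active_null_le1 hF hA hE hcoh hP.
split=> // monoE; apply: integral_ereal_sup_le => [t|t w|w|t].
- exact: (measurable_active_null_process hF hA hE).
- exact: (active_null_process_ge0 hA hE).
- exact: (active_null_process_homo hA hE hcoh).
- exact: stopped_le1 (stopping_time_const hF t) (as_finite_const P t).
Qed.
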